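(* Let $p\in[2,\infty)$. There exists a constant $C=C(a,b,d,K,L,\varrho,p)>0$ such that for every $n\ge\lfloor b-a\rfloor+1$ satisfying $Lh<1$ (with $h=(b-a)/n$) and every $(\eta,f)\in F^\varrho(a,b,d,K,L)$, $$\Bigl(\mathbb{E}\Bigl[\max_{0\le j\le n}\bigl\|z(t_j)-V^j_{S2}\bigr\|^p\Bigr]\Bigr)^{1/p}\le C h^{\varrho+\frac12},$$ where $z$ is the solution of $z'(t)=f(t,z(t))$, $t\in[a,b]$, $z(a)=\eta$, and $V^j_{S2}$ are the values produced by the implicit randomized RK2 scheme (S2).
   Context: Let $-\infty<a<b<\infty$, $d\in\mathbb{Z}_+$, $\varrho\in(0,1]$, $K,L\in(0,\infty)$. The class $F^\varrho=F^\varrho(a,b,d,K,L)$ consists of pairs $(\eta,f)$ with $\eta\in\mathbb{R}^d$, $f\colon[a,b]\times\mathbb{R}^d\to\mathbb{R}^d$ such that: $\|\eta\|\le K$; $f$ is continuous; $\|f(t,x)\|\le K(1+\|x\|)$ for all $(t,x)$; $\|f(t,x)-f(s,x)\|\le L|t-s|^\varrho$ for all $t,s\in[a,b]$, $x\in\mathbb{R}^d$; $\|f(t,x)-f(t,y)\|\le L\|x-y\|$ for all $t\in[a,b]$, $x,y\in\mathbb{R}^d$. For $n\in\mathbb{Z}_+$ put $h=(b-a)/n$, $t_j=a+jh$. Let $\tau_1,\tau_2,\ldots$ be independent random variables uniformly distributed on $[0,1]$ on a complete probability space; $\theta_j=t_{j-1}+h\tau_j$. The implicit randomized RK2 scheme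 (S2) is: $V^0=\eta$, and for $j=1,\ldots,n$: $V^j=V^{j-1}+hf(\theta_j,(1-\tau_j)V^{j-1}+\tau_jV^j)$ (the almost surely unique solution of this implicit equation, which exists when $Lh<1$). *)

(* Defs.v *)
From HB Require Import structures.
From mathcomp Require Import all_boot all_order all_algebra.
From mathcomp Require Import all_classical all_reals all_analysis.
Set Implicit Arguments. Unset Strict Implicit. Unset Printing Implicit Defensive.
Import Order.TTheory GRing.Theory Num.Theory.
Import numFieldNormedType.Exports.
Local Open Scope classical_set_scope.
Local Open Scope ring_scope.

Definition enorm {R : realType} {d : nat} (v : 'rV[R]_d) : R :=
  Num.sqrt (\sum_(i < d) v 0 i ^+ 2).

Definition inF {R : realType} {d : nat} (a b K L rho : R)
  (eta : 'rV[R]_d) (f : R -> 'rV[R]_d -> 'rV[R]_d) : Prop :=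
  [/\ enorm eta <= K,
      {within [set q : R * 'rV[R]_d | a <= q.1 <= b],
         continuous (fun q : R * 'rV[R]_d => f q.1 q.2)},
      (forall t x, a <= t <= b -> enorm (f t x) <= K * (1 + enorm x)),
      (forall t s x, a <= t <= b -> a <= s <= b ->
          enorm (f t x - f s x) <= L * `|t - s| `^ rho) &
      (forall t x y, a <= t <= b ->
          enorm (f t x - f t y) <= L * enorm (x - y))].

Definition ode_solution {R : realType} {d : nat} (a b : R)
  (eta : 'rV[R]_d) (f : R -> 'rV[R]_d -> 'rV[R]_d) (z : R -> 'rV[R]_d) : Prop :=
  [/\ z a = eta,
      {within `[a, b], continuous z} &
      (forall t, a < t < b -> is_derive t 1 z (f t (z t)))].

(* One implicit step: the (unique when L h < 1 and s in [0,1]) solution y of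
   y = x + h f(t + h s, (1 - s) x + s y); chosen by classical choice. *)
Definition S2_step {R : realType} {d : nat} (h t : R)
  (f : R -> 'rV[R]_d -> 'rV[R]_d) (x : 'rV[R]_d) (s : R) : 'rV[R]_d :=
  xget 0 [set y | y = x + h *: f (t + h * s) ((1 - s) *: x + s *: y)].

(* V^j of scheme (S2), given the sample values: taus j' stands for
   tau_{j'+1}, so theta_{j'+1} = t_{j'} + h * taus j'. *)
Fixpoint S2 {R : realType} {d : nat} (a h : R) (eta : 'rV[R]_d)
  (f : R -> 'rV[R]_d -> 'rV[R]_d) (taus : nat -> R) (j : nat) : 'rV[R]_d :=
  match j with
  | 0 => eta
  | j'.+1 => S2_step h (a + j'%:R * h) f (S2 a h eta f taus j') (taus j')
  end.

Definition mutually_independent {R : realType} {d0 : measure_display}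
  {T : measurableType d0} (P : probability T R) (X : nat -> T -> R) : Prop :=
  forall (J : seq nat) (B : nat -> set R), uniq J ->
    (forall j, measurable (B j)) ->
    P (\bigcap_(j in [set` J]) (X j @^-1` B j)) =
    (\prod_(j <- J) P (X j @^-1` B j))%E.

Definition uniform01 {R : realType} {d0 : measure_display}
  {T : measurableType d0} (P : probability T R) (X : T -> R) : Prop :=
  forall B : set R, measurable B ->
    P (X @^-1` B) = (@lebesgue_measure R) (B `&` `[0, 1]).

(* Main.v *)
(**
With [g t := f t (z t)], subtracting the scheme from the integrated equation gives
[e_k - e_(k-1) = X_k + h (g theta_k - f theta_k ((1 - tau_k) V_(k-1) + tau_k V_k))]
for the errors [e_k := z t_k - V_k], where
[X_k := z t_k - z t_(k-1) - h * g theta_k] depends on [tau_k] alone.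
The last bracket is bounded, through the Lipschitz condition, by the error
[O(h^(1 + rho))] of linear interpolation of [z] and by the errors [e_(k-1)], [e_k],
so a discrete Gronwall argument bounds every path of the error by
[max_k |X_1 + ... + X_k| + O(h^(1 + rho))], and only the [X_k], not the scheme,
need be measurable.

The [X_k] are independent, centered by the fundamental theorem of calculus, and
[O(h^(1 + rho))].  Bounding [|x|^m] by [m! (e^x + e^(-x))] and using independence
for the exponentials, the sum over a block of length [l] has [m]-th moment
[O((h^(1 + rho) sqrt l)^m)]; for [m > 2] dyadic bisection transfers this to the
maximum of the partial sums.  With [l = n = (b - a) / h] it is [h^(rho + 1/2)].
*)

Require Import Defs.
From HB Require Import structures.
From mathcomp Require Import finmap.
From mathcomp Require Import all_boot all_order all_algebra.
From mathcomp Require Import all_classical all_reals all_analysis measurable_realfun.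
From mathcomp Require Import ring lra.
Import Order.TTheory GRing.Theory Num.Theory.
Import numFieldNormedType.Exports.
Local Open Scope classical_set_scope.
Local Open Scope ring_scope.
Set Implicit Arguments.
Unset Strict Implicit.
Unset Printing Implicit Defensive.

(** * The Euclidean norm and its comparison with the max norm *)

Section EuclideanNorm.
Context {R : realType} {d : nat}.
Implicit Types u v x y : 'rV[R]_d.

Lemma enorm_ge0 v : 0 <= enorm v. Proof. exact: sqrtr_ge0. Qed.

Lemma sqr_enorm v : enorm v ^+ 2 = \sum_(i < d) v 0 i ^+ 2.
Proof. by rewrite sqr_sqrtr// sumr_ge0// => i _; exact: sqr_ge0. Qed.

Lemma enorm0 : enorm (0 : 'rV[R]_d) = 0.
Proof. by rewrite /enorm big1 ?sqrtr0// => i _; rewrite mxE expr0n. Qed.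

Lemma enormZ (c : R) v : enorm (c *: v) = `|c| * enorm v.
Proof.
rewrite /enorm -sqrtr_sqr -sqrtrM ?sqr_ge0// big_distrr/=.
by congr Num.sqrt; apply: eq_bigr => i _; rewrite mxE exprMn.
Qed.

Lemma enormN v : enorm (- v) = enorm v.
Proof. by rewrite -scaleN1r enormZ normrN1 mul1r. Qed.

Lemma cauchy_schwarz u v : \sum_(i < d) u 0 i * v 0 i <= enorm u * enorm v.
Proof.
have [u0|u0] := eqVneq (enorm u) 0.
  have uE i : u 0 i = 0.
    have : \sum_(i < d) u 0 i ^+ 2 = 0 by rewrite -sqr_enorm u0 expr0n.
    move=> /psumr_eq0P => /(_ (fun i _ => sqr_ge0 _)) /(_ i isT) /eqP.
    by rewrite sqrf_eq0 => /eqP.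
  by rewrite u0 mul0r big1// => i _; rewrite uE mul0r.
have [v0|v0] := eqVneq (enorm v) 0.
  have vE i : v 0 i = 0.
    have : \sum_(i < d) v 0 i ^+ 2 = 0 by rewrite -sqr_enorm v0 expr0n.
    move=> /psumr_eq0P => /(_ (fun i _ => sqr_ge0 _)) /(_ i isT) /eqP.
    by rewrite sqrf_eq0 => /eqP.
  by rewrite v0 mulr0 big1// => i _; rewrite vE mulr0.
have u1 : 0 < enorm u by rewrite lt_neqAle eq_sym u0 enorm_ge0.
have v1 : 0 < enorm v by rewrite lt_neqAle eq_sym v0 enorm_ge0.
(* This sum of squares expands to [2 * |u| |v| * (|u| |v| - <u, v>)], and both norms are now
   positive. *)
have : 0 <= \sum_(i < d) (enorm v * u 0 i - enorm u * v 0 i) ^+ 2.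
  by apply: sumr_ge0 => i _; exact: sqr_ge0.
have -> : \sum_(i < d) (enorm v * u 0 i - enorm u * v 0 i) ^+ 2 =
    2 * (enorm u * enorm v) * (enorm u * enorm v - \sum_(i < d) u 0 i * v 0 i).
  transitivity (enorm v ^+ 2 * (\sum_(i < d) u 0 i ^+ 2)
     + enorm u ^+ 2 * (\sum_(i < d) v 0 i ^+ 2)
     - 2 * (enorm u * enorm v) * (\sum_(i < d) u 0 i * v 0 i)).
    rewrite !big_distrr/= -big_split/= -sumrB; apply: eq_bigr => i _; ring.
  by rewrite -!sqr_enorm; ring.
by rewrite pmulr_rge0 ?subr_ge0// !mulr_gt0.
Qed.

Lemma ler_enormD u v : enorm (u + v) <= enorm u + enorm v.
Proof.
rewrite -(@ler_pXn2r _ 2)// ?nnegrE ?addr_ge0 ?enorm_ge0//.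
rewrite sqr_enorm sqrrD !sqr_enorm.
have -> : \sum_(i < d) (u + v) 0 i ^+ 2 = \sum_(i < d) u 0 i ^+ 2
   + (\sum_(i < d) u 0 i * v 0 i) *+ 2 + \sum_(i < d) v 0 i ^+ 2.
  by rewrite -sumrMnl -!big_split/=; apply: eq_bigr => i _; rewrite mxE sqrrD.
by rewrite lerD2r lerD2l ler_pMn2r// cauchy_schwarz.
Qed.

Lemma coord_le_enorm v i : `|v 0 i| <= enorm v.
Proof.
rewrite -sqrtr_sqr ler_wsqrtr// (bigD1 i)//= lerDl sumr_ge0// => j _.
exact: sqr_ge0.
Qed.

Lemma enorm_le_sum v : enorm v <= \sum_(i < d) `|v 0 i|.
Proof.
rewrite [v in enorm v]row_sum_delta.
elim/big_ind2 : _.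
- by rewrite enorm0.
- by move=> x1 x2 y1 y2 h1 h2; rewrite (le_trans (ler_enormD _ _))// lerD.
- move=> i _; rewrite enormZ ler_piMr//.
  rewrite /enorm (bigD1 i)//= mxE !eqxx expr1n big1 ?addr0 ?sqrtr1//.
  by move=> j ji; rewrite mxE eqxx (negbTE ji) expr0n.
Qed.

Lemma enorm_le_card v (c : R) : (forall i, `|v 0 i| <= c) -> enorm v <= d%:R * c.
Proof.
move=> vc; rewrite (le_trans (enorm_le_sum v))//.
by rewrite (le_trans (ler_sum _ (fun i _ => vc i)))// sumr_const card_ord mulr_natl.
Qed.

Lemma mx_norm_le_enorm v : `|v| <= enorm v.
Proof.
rewrite [leLHS]mx_normrE; apply: bigmax_le; first exact: enorm_ge0.
by move=> [i j] _ /=; rewrite ord1 coord_le_enorm.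
Qed.

Lemma enorm_le_mx_norm v : enorm v <= d%:R * `|v|.
Proof.
apply: enorm_le_card => i; rewrite [leRHS]mx_normrE.
exact: (le_bigmax _ (fun ij => `|v ij.1 ij.2|) (ord0, i)).
Qed.

End EuclideanNorm.

(** * Solvability of the implicit step and a discrete Gronwall inequality *)

Section ImplicitStep.
Context {R : realType} {d : nat}.

(* A Euclidean contraction need not contract the max norm of ['rV_d], but a
   high enough iterate does; its fixed point is a fixed point of [phi]. *)
Lemma enorm_contraction_fixpoint (phi : 'rV[R]_d -> 'rV[R]_d) (q : R) :
  0 <= q < 1 ->
  (forall x y, enorm (phi x - phi y) <= q * enorm (x - y)) ->
  exists y, y = phi y.
Proof.
move=> /andP[q0 q1] ctr.
have iter_ctr k x y : enorm (iter k phi x - iter k phi y) <= q ^+ k * enorm (x - y).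
  elim: k => [|k IH]; first by rewrite expr0 mul1r.
  by rewrite /= (le_trans (ctr _ _))// exprS -mulrA ler_wpM2l.
have [k kd] : exists k, q ^+ k * d%:R < 1.
  have : (fun k => q ^+ k * d%:R) @ \oo --> (0 * d%:R : R).
    by apply: cvgM; [apply: cvg_expr; rewrite ger0_norm|exact: cvg_cst].
  rewrite mul0r => /cvgrPdist_lt/(_ 1 ltr01) [N _ /(_ N (leqnn N))] /=.
  rewrite sub0r normrN ger0_norm; first by exists N.
  by rewrite mulr_ge0// exprn_ge0.
have fS : {homo iter k phi : x / setT x >-> setT x} by [].
pose F := mkfun_fun fS.
have FC : is_contraction F.
  have q'0 : 0 <= q ^+ k * d%:R by rewrite mulr_ge0// exprn_ge0.
  exists (NngNum q'0); split => //= -[x y] _ /=.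
  rewrite (le_trans (mx_norm_le_enorm _))// (le_trans (iter_ctr _ _ _))//.
  by rewrite -mulrA ler_wpM2l ?exprn_ge0// enorm_le_mx_norm.
pose X : completeNormedModType R :=
  HB.pack 'rV[R]_d (NormedModule.on 'rV[R]_d) (Complete.on 'rV[R]_d).
have [y _ yE] := @banach_fixed_point R X setT F FC closedT (ex_intro _ 0 Logic.I).
exists y; apply: (contraction_fixpoint_unique FC) => //.
by rewrite {1}yE /= /mkfun -iterS iterSr.
Qed.

(** The right-hand side is a contraction in [y] with constant [L * h], because [s <= 1]. Hence a
    solution exists, and [xget] returns a solution instead of its default [0]. *)
Lemma S2_stepE (h t s L : R) (f : R -> 'rV[R]_d -> 'rV[R]_d) (x : 'rV[R]_d) :
  0 <= h -> 0 <= s <= 1 -> 0 <= L -> L * h < 1 ->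
  (forall u v, enorm (f (t + h * s) u - f (t + h * s) v) <= L * enorm (u - v)) ->
  S2_step h t f x s =
  x + h *: f (t + h * s) ((1 - s) *: x + s *: S2_step h t f x s).
Proof.
move=> h0 /andP[s0 s1] L0 Lh lip.
suff [y yE] : exists y, y = x + h *: f (t + h * s) ((1 - s) *: x + s *: y).
  by rewrite {1}/S2_step; case: xgetP => [z -> //|/(_ y)].
apply: (@enorm_contraction_fixpoint
  (fun y => x + h *: f (t + h * s) ((1 - s) *: x + s *: y)) (L * h)) => [|u v].
  by rewrite mulr_ge0.
rewrite opprD addrACA subrr add0r -scalerBr enormZ ger0_norm//.
rewrite [L * h]mulrC -mulrA ler_wpM2l// (le_trans (lip _ _))// ler_wpM2l//.
rewrite opprD addrACA subrr add0r -scalerBr enormZ ger0_norm//.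
by rewrite ler_piMl// enorm_ge0.
Qed.

(** The recursion is run on [e - S], whose increments are small path by path, while [S] is only
    known to stay below [M]. The scheme being implicit, [e k.+1] also appears on the right;
    absorbing it divides by [1 - h * L * s k], which is at least [1 - q]. *)
Lemma discrete_gronwall (e S : nat -> 'rV[R]_d) (s : nat -> R)
    (q h L eps M : R) (n : nat) :
  0 <= h -> 0 <= L -> L * h <= q < 1 -> 0 <= eps ->
  e 0%N = 0 -> S 0%N = 0 -> (forall k, (k < n)%N -> 0 <= s k <= 1) ->
  (forall k, (k <= n)%N -> enorm (S k) <= M) ->
  (forall k, (k < n)%N -> enorm ((e k.+1 - S k.+1) - (e k - S k)) <=
     h * L * (eps + (1 - s k) * enorm (e k) + s k * enorm (e k.+1))) ->
  forall k, (k <= n)%N ->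
  enorm (e k) <= expR (n%:R * (h * L / (1 - q))) * (eps + M).
Proof.
move=> h0 L0 /andP[Lhq q1] eps0 e0 S0 s01 SM step.
set al := h * L / (1 - q).
have q1' : 0 < 1 - q by rewrite subr_gt0.
have al0 : 0 <= al by rewrite !mulr_ge0// invr_ge0 ltW.
have M0 : 0 <= M by rewrite (le_trans _ (SM 0%N isT))// enorm_ge0.
pose u k := enorm (e k - S k).
have eu k : (k <= n)%N -> enorm (e k) <= u k + M.
  move=> kn; rewrite -{1}(subrK (S k) (e k)) (le_trans (ler_enormD _ _))//.
  by rewrite lerD2l SM.
(* Shifting [u] by [eps + M] makes the affine recursion purely multiplicative. *)
have main k : (k <= n)%N -> u k + (eps + M) <= (1 + al) ^+ k * (eps + M).
  elim: k => [_|k IH kn]; first by rewrite /u e0 S0 subrr enorm0 add0r expr0 mul1r.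
  have {}IH := IH (ltnW kn).
  have /andP[s0 s1] := s01 k kn.
  have ustep : u k.+1 <= u k + h * L *
      (eps + (1 - s k) * (u k + M) + s k * (u k.+1 + M)).
    rewrite {1}/u -(subrK (e k - S k) (e k.+1 - S k.+1)).
    rewrite (le_trans (ler_enormD _ _))// addrC lerD2l (le_trans (step k kn))//.
    rewrite ler_wpM2l ?mulr_ge0//.
    by rewrite !lerD ?ler_wpM2l ?subr_ge0// eu// ltnW.
  have u0 j : 0 <= u j by exact: enorm_ge0.
  have hLs : h * L * s k <= q.
    by rewrite (le_trans _ Lhq)// [L * h]mulrC ler_piMr// mulr_ge0.
  have D0 : 0 < 1 - h * L * s k by rewrite subr_gt0 (le_lt_trans hLs).
  rewrite exprS -mulrA (@le_trans _ _ ((1 + al) * (u k + (eps + M))))//; last first.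
    by rewrite ler_wpM2l// addr_ge0.
  rewrite (@le_trans _ _ ((1 + h * L / (1 - h * L * s k)) * (u k + (eps + M))))//.
    rewrite -(ler_pM2r D0).
    have -> : (1 + h * L / (1 - h * L * s k)) * (u k + (eps + M)) *
       (1 - h * L * s k) = (1 - h * L * s k + h * L) * (u k + (eps + M)).
      by field; rewrite gt_eqF.
    by rewrite -subr_ge0; move: ustep; rewrite -subr_ge0; congr (0 <= _); ring.
  rewrite ler_wpM2r ?addr_ge0// lerD2l ler_wpM2l ?mulr_ge0// lef_pV2 ?posrE//.
  by rewrite lerB.
move=> k kn; rewrite (le_trans (eu k kn))//.
rewrite (@le_trans _ _ (u k + (eps + M))) ?lerD2l ?lerDr//.
rewrite (le_trans (main k kn))// ler_wpM2r ?addr_ge0//.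
rewrite (@le_trans _ _ (expR al ^+ k))//.
  by rewrite lerXn2r ?nnegrE ?expR_ge0 ?expR_ge1Dx ?addr_ge0.
by rewrite -expRM_natl ler_expR ler_wpM2r// ler_nat.
Qed.

End ImplicitStep.

(** * A priori bound and regularity of the exact solution *)

Lemma within_continuous_comp (U V W : topologicalType) (A : set U) (B : set V)
    (f : U -> V) (g : V -> W) :
  {within A, continuous f} -> {within B, continuous g} ->
  (forall x, A x -> B (f x)) -> {within A, continuous (g \o f)}.
Proof.
move=> /subspace_continuousP cf /subspace_continuousP cg AB.
apply/subspace_continuousP => x Ax.
have gE := cg _ (AB x Ax).
apply: (@cvg_comp _ _ _ f g (within A (nbhs x)) (within B (nbhs (f x))) _ _ gE).
move=> S; rewrite /within/= => nS.
have := cf x Ax _ nS.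
by apply: filterS2 (withinT A (nbhs_filter x)) => y Ay; apply; exact: AB.
Qed.

Section OdeSolution.
Context {R : realType} {d : nat}.

Lemma is_derive_coord (z : R -> 'rV[R]_d) (t : R) (v : 'rV[R]_d) (i : 'I_d) :
  is_derive t 1 z v -> is_derive t 1 (fun t => z t 0 i) (v 0 i).
Proof.
move=> [dz zv]; apply: DeriveDef; first by move/derivable_mxP : dz => /(_ 0 i).
by rewrite -zv derive_mx// mxE.
Qed.

Variables (a b K L rho : R) (eta : 'rV[R]_d) (f : R -> 'rV[R]_d -> 'rV[R]_d).
Variable z : R -> 'rV[R]_d.
Hypotheses (ab : a < b) (K0 : 0 < K) (L0 : 0 < L) (rho01 : 0 < rho <= 1).
Hypotheses (Ff : inF a b K L rho eta f) (odez : ode_solution a b eta f z).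

Let g t := f t (z t).

Lemma coord_solution_continuous i : {within `[a, b], continuous (fun t => z t 0 i)}.
Proof.
case: odez => _ cz _.
apply: (@within_continuous_comp _ _ _ _ setT z (fun v => v 0 i)) => //.
exact/continuous_subspaceT/coord_continuous.
Qed.

Lemma coord_rhs_continuous i : {within `[a, b], continuous (fun t => g t 0 i)}.
Proof.
case: odez => _ cz _; case: Ff => _ cf _ _ _.
apply: (@within_continuous_comp _ _ _ _ setT g (fun v => v 0 i)) => //; last first.
  exact/continuous_subspaceT/coord_continuous.
apply: (@within_continuous_comp _ _ _ _ _ (fun t => (t, z t)) _ _ cf).
  apply/subspace_continuousP => t tab.
  apply: (@cvg_pair R R 'rV[R]_d (within `[a, b] (nbhs t)) (nbhs t) (nbhs (z t))).
    exact: cvg_within.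
  by move/subspace_continuousP : cz; exact.
by move=> t /=; rewrite in_itv.
Qed.

Lemma coord_solution_derive i t : a < t < b ->
  is_derive t 1 (fun t => z t 0 i) (g t 0 i).
Proof.
by move=> tab; case: odez => _ _ dz; apply: is_derive_coord; exact: dz.
Qed.

Definition solution_bound : R := (1 + K ^+ 2) * expR (4 * K * (b - a)).

(** Linear growth gives [v' <= 4 * K * v] for [v = 1 + |z|^2], so [v] times [exp (- 4 K t)] is
    nonincreasing; the square keeps [v] differentiable where [z] vanishes. The bound then follows
    from [|z| <= 1 + |z|^2]. It depends on [a], [b] and [K] alone, which makes the later constants
    uniform over the class. *)
Lemma enorm_solution_le t : a <= t <= b -> enorm (z t) <= solution_bound.
Proof.
move=> /andP[at_ tb]; case: (odez) => za cz dz; case: Ff => etaK _ fK _ _.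
pose v (t : R) : R := 1 + \sum_(i < d) z t 0 i ^+ 2.
pose E (t : R) : R := expR (- (4 * K) * t).
have vE x : v x = 1 + enorm (z x) ^+ 2 by rewrite /v sqr_enorm.
have dv x : a < x < b ->
    is_derive x 1 v (2 * \sum_(i < d) z x 0 i * g x 0 i).
  move=> xab.
  have -> : v = cst 1 + \sum_(i < d) (fun t => z t 0 i ^+ 2).
    by apply/funext => y; rewrite /v /= fct_sumE.
  have D1 i : is_derive x 1 (fun t => z t 0 i ^+ 2) (2 * (z x 0 i * g x 0 i)).
    have Di := coord_solution_derive i xab.
    have -> : (fun t => z t 0 i ^+ 2) = (fun t => z t 0 i) ^+ 2 by [].
    apply: is_derive_eq; rewrite /GRing.scale/=; ring.
  apply: is_derive_eq; rewrite add0r big_distrr/=; apply: eq_bigr => i _; ring.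
have dE (x : R) : is_derive x 1 E (- (4 * K) * E x).
  rewrite /E; apply: is_derive_eq; rewrite /GRing.scale/=; ring.
have dvE x : a < x < b -> is_derive x 1 (v * E)
    (E x * (2 * (\sum_(i < d) z x 0 i * g x 0 i) - 4 * K * v x)).
  move=> xab; have := dv x xab; have := dE x => ? ?.
  apply: is_derive_eq; rewrite /GRing.scale/=; ring.
have cvE : {within `[a, b], continuous (v * E)}.
  move=> x; apply: continuousM; last first.
    apply: continuous_subspaceT => y.
    have := dE y => -[dy _]; exact/differentiable_continuous/derivable1_diffP.
  apply: continuousD; first exact: cst_continuous.
  rewrite /continuous_at; apply: cvg_big => [|i _]; first exact: add_continuous.
  have ci := @coord_solution_continuous i x.
  by apply: (continuousM ci ci).
have dle x : x \in `]a, b[ -> derive1 (v * E) x <= 0.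
  rewrite in_itv/= => xab; rewrite derive1E.
  have [_ ->] := dvE x xab.
  have xab' : a <= x <= b by case/andP: xab => /ltW-> /ltW->.
  rewrite pmulr_rle0 ?expR_gt0// subr_le0 vE.
  have h1 := cauchy_schwarz (z x) (g x).
  have h2 := fK x (z x) xab'.
  set y := enorm (z x) in h1 h2 *.
  have y0 : 0 <= y by exact: enorm_ge0.
  have h3 : y * enorm (g x) <= y * (K * (1 + y)) by exact: ler_wpM2l.
  have h4 : K * (2 * (y * (1 + y))) <= K * (4 * (1 + y ^+ 2)).
    rewrite ler_pM2l//.
    have : 0 <= (y - 1) ^+ 2 by exact: sqr_ge0.
    have : 0 <= y ^+ 2 by exact: sqr_ge0.
    by rewrite !expr2 => ? ?; nra.
  have := le_trans h1 h3; rewrite /g; nra.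
have derx x : x \in `]a, b[ -> derivable (v * E) x 1.
  by rewrite in_itv/= => xab; have [] := dvE x xab.
have := @ler0_derive1_le_cc _ _ _ _ derx dle cvE t a.
rewrite !in_itv/= lexx at_ tb (ltW ab)/= => /(_ isT isT isT).
rewrite -[(v * E) t]/(v t * E t) -[(v * E) a]/(v a * E a).
rewrite /E !mulNr !expRN ler_pdivrMr ?expR_gt0//.
rewrite -mulrA [_^-1 * _]mulrC -expRB -mulrBr => vt.
have W : v t <= solution_bound.
  rewrite (le_trans vt)// /solution_bound ler_pM ?expR_ge0//.
  - by rewrite vE addr_ge0// sqr_ge0.
  - by rewrite vE lerD2l lerXn2r ?nnegrE ?enorm_ge0// ?(ltW K0)// za.
  - by rewrite ler_expR ler_pM2l ?mulr_gt0// lerB.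
rewrite (le_trans _ W)// vE.
have : 0 <= (enorm (z t) - 1) ^+ 2 by exact: sqr_ge0.
have : 0 <= enorm (z t) ^+ 2 by exact: sqr_ge0.
by rewrite !expr2 => ? ?; nra.
Qed.

Definition rhs_bound : R := K * (1 + solution_bound).

Definition holder_const : R := L * (1 + d%:R * rhs_bound).

Lemma solution_bound_ge0 : 0 <= solution_bound.
Proof. by rewrite mulr_ge0 ?expR_ge0// addr_ge0// sqr_ge0. Qed.

Lemma rhs_bound_ge0 : 0 <= rhs_bound.
Proof. by rewrite mulr_ge0 ?(ltW K0)// addr_ge0// solution_bound_ge0. Qed.

Lemma holder_const_gt0 : 0 < holder_const.
Proof. by rewrite mulr_gt0// ltr_wpDr// mulr_ge0// rhs_bound_ge0. Qed.

Lemma enorm_rhs_le t : a <= t <= b -> enorm (g t) <= rhs_bound.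
Proof.
move=> tab; case: Ff => _ _ fK _ _; rewrite (le_trans (fK _ _ tab))//.
by rewrite ler_pM2l// lerD2l enorm_solution_le.
Qed.

(** The mean value theorem holds only coordinatewise, with [c] depending on [i]. This is the origin
    of the factors [d%:R] in the constants. *)
Lemma solution_MVT i s t : a <= s -> s <= t -> t <= b ->
  exists2 c, s <= c <= t & z t 0 i - z s 0 i = g c 0 i * (t - s).
Proof.
move=> as_ st tb.
have [|/=|c] := @MVT_segment R (fun t => z t 0 i) (fun t => g t 0 i) s t st.
- move=> x; rewrite in_itv/= => /andP[sx xt].
  by apply: coord_solution_derive; rewrite (le_lt_trans as_ sx) (lt_le_trans xt tb).
- apply: (continuous_subspaceW _ (@coord_solution_continuous i)).
  by apply: subset_itvScc; rewrite bnd_simp.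
- by rewrite in_itv/=; exists c.
Qed.

Lemma solution_lipschitz s t : a <= s <= b -> a <= t <= b ->
  enorm (z t - z s) <= d%:R * (rhs_bound * `|t - s|).
Proof.
wlog st : s t / s <= t => [hwlog|] sab tab.
  have [st|/ltW st] := leP s t; first exact: hwlog.
  by rewrite -enormN opprB distrC; exact: hwlog.
apply: enorm_le_card => i; rewrite !mxE.
case/andP: sab => as_ _; case/andP: tab => _ tb.
have [c /andP[sc ct] ->] := solution_MVT i as_ st tb.
rewrite normrM ler_wpM2r// (le_trans (coord_le_enorm _ _))// enorm_rhs_le//.
by rewrite (le_trans as_ sc) (le_trans ct tb).
Qed.

(** Moving time first and space second uses the Hölder and then the Lipschitz condition on [f]. The
    Lipschitz part is of order [h], and [h <= h ^ rho] because [h <= 1] and [rho <= 1]. *)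
Lemma rhs_holder s t h : 0 < h <= 1 -> a <= s <= b -> a <= t <= b ->
  `|t - s| <= h -> enorm (g t - g s) <= holder_const * h `^ rho.
Proof.
move=> h01 sab tab tsh; case: Ff => _ _ _ fh fl; case/andP: rho01 => r0 r1.
have h0 : 0 <= h by case/andP: h01 => /ltW.
have -> : g t - g s = (f t (z t) - f s (z t)) + (f s (z t) - f s (z s)).
  by rewrite addrA subrK.
rewrite (le_trans (ler_enormD _ _))// /holder_const mulrDr mulr1 mulrDl lerD//.
  rewrite (le_trans (fh _ _ _ _ _))// ler_pM2l//.
  by rewrite ge0_ler_powR ?nnegrE// ltW.
rewrite (le_trans (fl _ _ _ _))// -mulrA ler_pM2l//.
rewrite (le_trans (solution_lipschitz _ _))// -mulrA ler_wpM2l//.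
rewrite ler_wpM2l ?rhs_bound_ge0// (le_trans tsh)//.
exact: ger1_powR.
Qed.

(** * Quadrature and interpolation errors on one step *)

Section Step.
Variables (t0 h : R).
Hypotheses (at0 : a <= t0) (t0b : t0 + h <= b) (h01 : 0 < h <= 1).

Let h0 : 0 < h. Proof. by case/andP: h01. Qed.

Let node_itv s : 0 <= s <= 1 -> t0 <= t0 + h * s <= t0 + h.
Proof.
move=> /andP[s0 s1]; rewrite lerDl mulr_ge0 ?(ltW h0)//= lerD2l.
by rewrite ler_piMr// ltW.
Qed.

Let sub_itv t : t0 <= t <= t0 + h -> a <= t <= b.
Proof. by move=> /andP[h1 h2]; rewrite (le_trans at0 h1) (le_trans h2 t0b). Qed.

Let rhs_close i s t : t0 <= s <= t0 + h -> t0 <= t <= t0 + h ->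
  `|g t 0 i - g s 0 i| <= holder_const * h `^ rho.
Proof.
move=> sI tI; have -> : g t 0 i - g s 0 i = (g t - g s) 0 i by rewrite !mxE.
rewrite (le_trans (coord_le_enorm _ _))// rhs_holder ?sub_itv//.
by case/andP: sI => ? ?; case/andP: tI => ? ?; rewrite ler_norml; apply/andP; split; lra.
Qed.

Lemma quadrature_error_le i s : 0 <= s <= 1 ->
  `|z (t0 + h) 0 i - z t0 0 i - h * g (t0 + h * s) 0 i|
    <= holder_const * (h * h `^ rho).
Proof.
move=> s01; have t0h : t0 <= t0 + h by rewrite lerDl ltW.
have [c cI ->] := solution_MVT i at0 t0h t0b.
rewrite addrAC subrr add0r mulrC -mulrBr normrM (gtr0_norm h0).
by rewrite mulrCA ler_pM2l// rhs_close// node_itv.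
Qed.

(** The mean value theorem on both sides of the node turns each coordinate of the error into
    [(1 - s) * s * h * (g c1 - g c2)]. The first-order terms cancel, and the Hölder bound on [g]
    supplies the extra [h ^ rho]. *)
Lemma interpolation_error_le s : 0 <= s <= 1 ->
  enorm (z (t0 + h * s) - ((1 - s) *: z t0 + s *: z (t0 + h)))
    <= d%:R * (holder_const * (h * h `^ rho)).
Proof.
move=> s01; apply: enorm_le_card => i; rewrite !mxE.
have /andP[n1 n2] := node_itv s01.
case/andP: (s01) => s0 s1.
have [c1 /andP[c11 c12] E1] := solution_MVT i at0 n1 (le_trans n2 t0b).
have [c2 /andP[c21 c22] E2] := solution_MVT i (le_trans at0 n1) n2 t0b.
have -> : z (t0 + h * s) 0 i - ((1 - s) * z t0 0 i + s * z (t0 + h) 0 i) =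
   (1 - s) * (z (t0 + h * s) 0 i - z t0 0 i) -
   s * (z (t0 + h) 0 i - z (t0 + h * s) 0 i) by ring.
rewrite E1 E2.
have -> : (1 - s) * (g c1 0 i * (t0 + h * s - t0)) -
   s * (g c2 0 i * (t0 + h - (t0 + h * s))) =
   ((1 - s) * s) * (h * (g c1 0 i - g c2 0 i)) by ring.
rewrite normrM ger0_norm ?mulr_ge0 ?subr_ge0//.
rewrite (@le_trans _ _ `|h * (g c1 0 i - g c2 0 i)|)//.
  rewrite ler_piMl// (le_trans (ler_piMl _ _))//; lra.
rewrite normrM (gtr0_norm h0) mulrCA ler_pM2l// rhs_close//.
  by rewrite (le_trans n1 c21) c22.
by rewrite c11 (le_trans c12 n2).
Qed.

(** Extended by zero outside [[0, 1]], where the node may leave [[a, b]] and nothing is known about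
    [g]; the result is measurable and bounded on the whole line. *)
Definition quadrature_error (i : 'I_d) : R -> R :=
  (fun s => z (t0 + h) 0 i - z t0 0 i - h * g (t0 + h * s) 0 i) \_ `[0, 1].

Let node_continuous (A : set R) : {within A, continuous (fun s => t0 + h * s)}.
Proof.
apply: continuous_subspaceT => x.
by apply: cvgD; [exact: cvg_cst|apply: cvgM; [exact: cvg_cst|exact: cvg_id]].
Qed.

Let raw_error_continuous i : {within `[0, 1], continuous
  (fun s => z (t0 + h) 0 i - z t0 0 i - h * g (t0 + h * s) 0 i)}.
Proof.
have cg : {within `[0, 1], continuous (fun s => g (t0 + h * s) 0 i)}.
  apply: (@within_continuous_comp _ _ _ _ _ (fun s => t0 + h * s)
     (fun t => g t 0 i) (@node_continuous _) (@coord_rhs_continuous i)).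
  by move=> s /=; rewrite !in_itv/= => s01; rewrite sub_itv ?node_itv.
move/subspace_continuousP : cg => cg; apply/subspace_continuousP => s sI.
apply: cvgB; first exact: cvg_cst.
by apply: cvgM; [exact: cvg_cst|exact: cg].
Qed.

Lemma measurable_quadrature_error i : measurable_fun setT (quadrature_error i).
Proof.
apply/(measurable_restrictT _ _).1; first exact: measurable_itv.
apply: subspace_continuous_measurable_fun; first exact: measurable_itv.
exact: raw_error_continuous.
Qed.

Lemma norm_quadrature_error_le i s :
  `|quadrature_error i s| <= holder_const * (h * h `^ rho).
Proof.
rewrite /quadrature_error patchE; case: ifPn => [|_].
  by rewrite inE/= in_itv/= => s01; exact: quadrature_error_le.
by rewrite normr0 mulr_ge0 ?ltW ?holder_const_gt0// mulr_gt0// powR_gt0.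
Qed.

Lemma integral_quadrature_error i :
  (\int[lebesgue_measure]_(s in `[0%R, 1%R]) (quadrature_error i s)%:E = 0)%E.
Proof.
pose Dz := z (t0 + h) 0 i - z t0 0 i.
(* An antiderivative of the error taking the same value at [0] and at [1]. *)
pose F s := Dz * s - z (t0 + h * s) 0 i.
transitivity (\int[lebesgue_measure]_(s in `[0%R, 1%R])
    (Dz - h * g (t0 + h * s) 0 i)%:E)%E.
  by apply: eq_integral => s s01; rewrite /quadrature_error patchE s01.
have dF (s : R) : 0 < s < 1 -> is_derive s 1 F (Dz - h * g (t0 + h * s) 0 i).
  move=> /andP[s0 s1].
  have tI : a < t0 + h * s < b.
    rewrite (le_lt_trans at0) ?ltrDl ?mulr_gt0//=.
    by rewrite (lt_le_trans _ t0b)// ltrD2l gtr_pMr.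
  have D1 : is_derive s 1 (fun s => t0 + h * s) h.
    by apply: is_derive_eq; rewrite /GRing.scale/=; ring.
  have D2 := coord_solution_derive i tI.
  have D3 : is_derive s 1 (fun s => z (t0 + h * s) 0 i) (h * g (t0 + h * s) 0 i).
    rewrite mulrC.
    exact: (@is_derive1_comp _ (fun t => z t 0 i) (fun s => t0 + h * s) s _ _ D2 D1).
  have -> : F = (fun s => Dz * s) - (fun s => z (t0 + h * s) 0 i) by [].
  by apply: is_derive_eq; rewrite /GRing.scale/=; ring.
have cF : {within `[0, 1], continuous F}.
  have : {within `[0, 1], continuous (fun s => z (t0 + h * s) 0 i)}.
    apply: (@within_continuous_comp _ _ _ _ _ (fun s => t0 + h * s)
       (fun t => z t 0 i) (@node_continuous _) (@coord_solution_continuous i)).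
    by move=> x /=; rewrite !in_itv/= => x01; rewrite sub_itv ?node_itv.
  move/subspace_continuousP => cz; apply/subspace_continuousP => s sI.
  apply: cvgB; last exact: cz.
  by apply: cvgM; [exact: cvg_cst|exact: cvg_within].
rewrite (@continuous_FTC2 _ _ F)//.
- by rewrite -EFinB; congr EFin; rewrite /F /Dz !mulr1 !mulr0 !addr0; ring.
- exact: raw_error_continuous.
- have [_ F0 F1] := (continuous_within_itvP F ltr01).1 cF.
  split => // s; rewrite in_itv/= => s01.
  by have [] := dF s s01.
- by move=> s; rewrite in_itv/= => s01; rewrite derive1E; have [_ ->] := dF s s01.
Qed.

End Step.
End OdeSolution.

(** * Product formula for expectations of functions of independent variables *)

Section Independence.
Context {R : realType} {d0 : measure_display} {T : measurableType d0}.
Variable P : probability T R.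

Import HBNNSimple.

Lemma ge0_integralM_nnsfun (Y X : T -> R) (g : {nnsfun R >-> R}) :
  measurable_fun setT Y -> measurable_fun setT X -> (forall w, 0 <= Y w) ->
  (\int[P]_w (Y w * g (X w))%:E = \sum_(y \in range g)
     (y%:E * \int[P]_w (Y w * \1_(g @^-1` [set y]) (X w))%:E))%E.
Proof.
move=> mY mX Y0.
have mYI y : measurable_fun setT (fun w => (Y w * \1_(g @^-1` [set y]) (X w))%:E).
  apply/measurable_EFinP; apply: measurable_funM => //.
  by apply: measurableT_comp => //; exact: measurable_indic.
have r0 y : y \in range g -> 0 <= y.
  by rewrite inE => -[x _ <-].
(* On the range of [g] the factor [Num.max 0 y] is [y]; it keeps the summand nonnegative for every
   real [y], as the exchange of sum and integral demands. *)
transitivity (\int[P]_w (\sum_(y <- fset_set (range g))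
  (Num.max 0 y * (Y w * \1_(g @^-1` [set y]) (X w)))%:E))%E.
  apply: eq_integral => w _; rewrite sumEFin; congr EFin.
  rewrite [g (X w)](fimfunE g) fsbig_finite//= big_distrr/= big_seq [RHS]big_seq.
  apply: eq_bigr => y; rewrite in_fset_set// => /r0 y0.
  by rewrite maxEle y0 mulrCA.
rewrite ge0_integral_sum//; last 2 first.
- by move=> y; under eq_fun do rewrite EFinM; exact: measurable_funeM.
- by move=> y w _; rewrite lee_fin mulr_ge0// ?le_max ?lexx// mulr_ge0.
rewrite fsbig_finite//= big_seq [RHS]big_seq; apply: eq_bigr => y.
rewrite in_fset_set// => /r0 y0; rewrite maxEle y0.
under eq_integral do rewrite EFinM.
by rewrite ge0_integralZl// => w _; rewrite lee_fin mulr_ge0.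
Qed.

(** The product rule for indicators extends linearly to simple functions, then to [phi] by monotone
    convergence. Finiteness of the integral of [Y] lets the limit pass through the product on the
    right. *)
Lemma ge0_integralM_indep (Y X : T -> R) (phi : R -> R) :
  measurable_fun setT Y -> measurable_fun setT X -> measurable_fun setT phi ->
  (forall w, 0 <= Y w) -> (forall x, 0 <= phi x) ->
  (\int[P]_w (Y w)%:E)%E \is a fin_num ->
  (forall B, measurable B -> (\int[P]_w (Y w * \1_B (X w))%:E =
     \int[P]_w (Y w)%:E * P (X @^-1` B))%E) ->
  (\int[P]_w (Y w * phi (X w))%:E =
   \int[P]_w (Y w)%:E * \int[P]_w (phi (X w))%:E)%E.
Proof.
move=> mY mX mphi Y0 phi0 Yfin YX.
have mEphi : measurable_fun [set: R] (EFin \o phi) by exact/measurable_EFinP.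
have phi0' : forall x : R, setT x -> (0 <= (EFin \o phi) x)%E.
  by move=> x _; rewrite lee_fin.
pose g := nnsfun_approx measurableT mEphi.
have simple n : (\int[P]_w (Y w * g n (X w))%:E =
   \int[P]_w (Y w)%:E * \int[P]_w (g n (X w))%:E)%E.
  have -> : (\int[P]_w (g n (X w))%:E = \int[P]_w (cst 1 w * g n (X w))%:E)%E.
    by apply: eq_integral => w _; rewrite mul1r.
  rewrite !ge0_integralM_nnsfun// !fsbig_finite//= ge0_sume_distrr => [|y].
    apply: eq_bigr => y _; rewrite YX// muleCA; congr (_ * (_ * _))%E.
    rewrite -[X in P X]setIT -integral_indic//; last first.
      by rewrite -[X in measurable X]setTI; exact: mX.
    by apply: eq_integral => w _; rewrite mul1r.
  have [yr _|yr _] := boolP (y \in range (g n)).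
    rewrite mule_ge0//; last by apply: integral_ge0 => w _; rewrite lee_fin mulr_ge0.
    by move: yr; rewrite inE lee_fin => -[x _ <-].
  rewrite integral0_eq ?mule0// => w _; rewrite indicE memNset ?mulr0//= => gy.
  by move: yr; rewrite notin_setE; apply; exists (X w).
have cvgg x : (EFin \o g ^~ x) @ \oo --> (phi x)%:E.
  exact: (cvg_nnsfun_approx measurableT mEphi phi0').
have ndg x : {homo (g ^~ x) : n m / (n <= m)%N >-> n <= m}.
  by move=> n m nm; exact/lefP/nd_nnsfun_approx.
have mgX n : measurable_fun setT (g n \o X) by exact: measurableT_comp.
have L1 : (\int[P]_w (Y w * g n (X w))%:E)%E @[n --> \oo] -->
          (\int[P]_w (Y w * phi (X w))%:E)%E.
  rewrite (_ : \int[P]_w (Y w * phi (X w))%:E =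
    \int[P]_w limn (fun n => (Y w * g n (X w))%:E))%E.
    apply: cvg_monotone_convergence => //.
    - by move=> n; apply/measurable_EFinP; apply: measurable_funM => //; exact: mgX.
    - by move=> n w _; rewrite lee_fin mulr_ge0.
    - by move=> w _ n m nm; rewrite lee_fin ler_wpM2l// ndg.
  apply: eq_integral => w _; apply/esym/cvg_lim => //.
  rewrite EFinM; under eq_fun do rewrite EFinM.
  exact/cvgeZl/cvgg.
have L2 : (\int[P]_w (g n (X w))%:E)%E @[n --> \oo] -->
          (\int[P]_w (phi (X w))%:E)%E.
  rewrite (_ : \int[P]_w (phi (X w))%:E =
    \int[P]_w limn (fun n => (g n (X w))%:E))%E.
    apply: cvg_monotone_convergence => //.
    - by move=> n; apply/measurable_EFinP; exact: mgX.
    - by move=> n w _; rewrite lee_fin.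
    - by move=> w _ n m nm; rewrite lee_fin ndg.
  by apply: eq_integral => w _; apply/esym/cvg_lim => //; exact: cvgg.
have L3 : (\int[P]_w (Y w)%:E * \int[P]_w (g n (X w))%:E)%E @[n --> \oo] -->
          (\int[P]_w (Y w)%:E * \int[P]_w (phi (X w))%:E)%E.
  exact: cvgeZl.
rewrite (funext simple) in L1.
exact: cvg_unique L1 L3.
Qed.

(** Mixing functions over [J1] with indicators over [J2] makes an induction on [J1] possible. With
    [J1] empty this is the definition of independence; to treat [j] in [J1], the induction
    hypothesis with [j] moved to [J2] provides the indicator rule that [ge0_integralM_indep] asks
    for. *)
Lemma integral_prod_indep_indic (tau : nat -> {RV P >-> R}) (phi : nat -> R -> R)
    (B : nat -> set R) (J1 J2 : seq nat) :
  mutually_independent P (fun j => tau j) ->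
  (forall j, measurable_fun setT (phi j)) -> (forall j x, 0 <= phi j x) ->
  (forall j, (\int[P]_w (phi j (tau j w))%:E)%E \is a fin_num) ->
  (forall j, measurable (B j)) -> uniq (J1 ++ J2) ->
  (\int[P]_w ((\prod_(j <- J1) phi j (tau j w)) *
              (\prod_(j <- J2) \1_(B j) (tau j w)))%:E =
   (\prod_(j <- J1) \int[P]_w (phi j (tau j w))%:E) *
   (\prod_(j <- J2) P (tau j @^-1` B j)))%E.
Proof.
move=> indep mphi phi0 phifin.
have mtau (C : set R) j : measurable C -> measurable (tau j @^-1` C).
  by move=> mC; exact: measurable_funPTI.
elim: J1 J2 B => [|j J1 IH] J2 B mB /=.
  move=> uJ2; rewrite big_nil mul1e -(indep _ _ uJ2 mB).
  have -> : (\bigcap_(j in [set` J2]) (tau j @^-1` B j)) =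
            \big[setI/setT]_(j <- J2) (tau j @^-1` B j).
    by rewrite -bigcap_seq.
  rewrite -[X in P X]setIT -integral_indic//; last first.
    by apply: bigsetI_measurable => j _; exact: mtau.
  apply: eq_integral => w _; rewrite big_nil mul1r; congr EFin.
  elim: J2 {uJ2} => [|j J2 IH2]; first by rewrite !big_nil indicT.
  by rewrite !big_cons indicI IH2/=.
move=> /andP[jJ uJ].
(* The family [B] is changed to [C] at [j] only; since [j] is not in [J2], the other factors are
   unaffected. *)
have jE (C : set R) : measurable C -> forall i,
    measurable (if i == j then C else B i) by move=> mC i; case: ifP.
have uJ' : uniq (J1 ++ j :: J2).
  by rewrite -cat1s uniq_catCA/= jJ.
have j2 : j \notin J2 by apply: contra jJ; rewrite mem_cat => ->; rewrite orbT.
pose Y w := (\prod_(j <- J1) phi j (tau j w)) *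
              (\prod_(j <- J2) \1_(B j) (tau j w)).
have IY := IH J2 B mB uJ.
have mY : measurable_fun setT Y.
  apply: measurable_funM; apply: measurable_prod => i _.
    exact: measurableT_comp.
  by apply: measurableT_comp => //; exact: measurable_indic.
have Y0 w : 0 <= Y w.
  by rewrite mulr_ge0//; apply: prodr_ge0 => i _.
have Yfin : (\int[P]_w (Y w)%:E)%E \is a fin_num.
  rewrite IY fin_numM//; apply/prode_fin_num => i _ //.
  by rewrite fin_num_measure//; exact: mtau.
transitivity (\int[P]_w (Y w * phi j (tau j w))%:E)%E.
  by apply: eq_integral => w _; congr EFin; rewrite big_cons /Y; ring.
rewrite (@ge0_integralM_indep Y (tau j) (phi j))//.
  by rewrite IY big_cons muleC muleA.
move=> C mC.
have := IH (j :: J2) _ (jE C mC) uJ'.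
have E2 (F : nat -> set R -> \bar R) :
  (\prod_(i <- J2) F i (if i == j then C else B i) = \prod_(i <- J2) F i (B i))%E.
  rewrite big_seq [RHS]big_seq; apply: eq_bigr => i iJ.
  by case: eqP => // ij; move: j2; rewrite -ij iJ.
have E3 w : \prod_(i <- J2) \1_(if i == j then C else B i) (tau i w) =
            \prod_(i <- J2) \1_(B i) (tau i w) :> R.
  rewrite big_seq [RHS]big_seq; apply: eq_bigr => i iJ.
  by case: eqP => // ij; move: j2; rewrite -ij iJ.
rewrite big_cons eqxx (E2 (fun i D => P (tau i @^-1` D))) => E.
rewrite IY -muleA [X in (_ * X)%E]muleC -E.
apply: eq_integral => w _; congr EFin.
by rewrite big_cons eqxx E3 /Y; ring.
Qed.

Lemma integral_prod_indep (tau : nat -> {RV P >-> R}) (phi : nat -> R -> R)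
    (J : seq nat) :
  mutually_independent P (fun j => tau j) ->
  (forall j, measurable_fun setT (phi j)) -> (forall j x, 0 <= phi j x) ->
  (forall j, (\int[P]_w (phi j (tau j w))%:E)%E \is a fin_num) ->
  uniq J ->
  (\int[P]_w (\prod_(j <- J) phi j (tau j w))%:E =
   \prod_(j <- J) \int[P]_w (phi j (tau j w))%:E)%E.
Proof.
move=> indep mphi phi0 phifin uJ.
have := @integral_prod_indep_indic tau phi (fun=> setT) J [::] indep mphi phi0
  phifin (fun=> measurableT).
rewrite cats0 big_nil mule1 => <-//.
by apply: eq_integral => w _; rewrite big_nil mulr1.
Qed.

End Independence.

(** * Moments and maxima of sums of bounded centered independent variables *)

Section MaximalInequality.
Context {R : realType}.

(** From [expR x * (1 - x) <= 1], since [(1 + x + 2 x^2) (1 - x) = 1 + x^2 (1 - 2 x)] is at least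
    [1] here. *)
Lemma expR_le_quadratic (x : R) : x <= 2^-1 -> expR x <= 1 + x + 2 * x ^+ 2.
Proof.
move=> x2.
have h1 : expR x * (1 - x) <= 1.
  rewrite -[leRHS](expRxMexpNx_1 x) ler_wpM2l ?expR_ge0//.
  by have := expR_ge1Dx (- x).
have h0 : 0 < 1 - x by lra.
rewrite -(ler_pM2r h0) (le_trans h1)//.
have -> : (1 + x + 2 * x ^+ 2) * (1 - x) = 1 + x ^+ 2 * (1 - 2 * x) by ring.
rewrite lerDl mulr_ge0 ?sqr_ge0//; lra.
Qed.

(** The coefficient of [|y| ^+ q] must not grow with [q], or the bisection would not close. If [|y|]
    dominates [2 q |x|], then [(1 + 1 / (2 q)) ^ q <= exp (1 / 2) <= 2]; otherwise [|x|] carries the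
    whole sum. *)
Lemma normrD_exp_le (q : nat) (x y : R) : (0 < q)%N ->
  `|x + y| ^+ q <= (1 + 2 * q%:R) ^+ q * `|x| ^+ q + 2 * `|y| ^+ q.
Proof.
move=> q0; have qR : 0 < q%:R :> R by rewrite ltr0n.
have [xy|xy] := leP (2 * q%:R * `|x|) `|y|.
- have le1 : `|x + y| <= (1 + (2 * q%:R)^-1) * `|y|.
    rewrite (le_trans (ler_normD _ _))// mulrDl mul1r addrC lerD2l.
    by rewrite mulrC ler_pdivlMr 1?mulrC// mulr_gt0.
  have le2 : (1 + (2 * q%:R)^-1) ^+ q <= 2 :> R.
    rewrite (@le_trans _ _ (expR (2 * q%:R)^-1 ^+ q))//.
      by rewrite lerXn2r ?nnegrE ?expR_ge0 ?addr_ge0 ?invr_ge0 ?mulr_ge0 ?expR_ge1Dx.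
    rewrite -expRM_natl invfM mulrCA mulfV ?gt_eqF// mulr1.
    by rewrite (le_trans (expR_le_quadratic _))//; lra.
  rewrite (@le_trans _ _ (2 * `|y| ^+ q))//.
    rewrite (@le_trans _ _ (((1 + (2 * q%:R)^-1) * `|y|) ^+ q))//.
      by rewrite lerXn2r ?nnegrE ?mulr_ge0 ?addr_ge0 ?invr_ge0 ?mulr_ge0.
    by rewrite exprMn ler_wpM2r// exprn_ge0.
  by rewrite lerDr mulr_ge0 ?exprn_ge0 ?addr_ge0 ?mulr_ge0.
- rewrite (@le_trans _ _ ((1 + 2 * q%:R) ^+ q * `|x| ^+ q))//; last first.
    by rewrite lerDl mulr_ge0 ?exprn_ge0.
  rewrite -exprMn lerXn2r ?nnegrE ?mulr_ge0 ?addr_ge0 ?mulr_ge0//.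
  by rewrite (le_trans (ler_normD _ _))// mulrDl mul1r lerD2l ltW.
Qed.

Lemma exprn_le_expRDexpRN (q : nat) (x : R) : (0 < q)%N ->
  `|x| ^+ q <= q`!%:R * (expR x + expR (- x)).
Proof.
case: q => // q _; have f0 : 0 < q.+1`!%:R :> R by rewrite ltr0n fact_gt0.
have h : `|x| ^+ q.+1 <= q.+1`!%:R * expR `|x|.
  rewrite -ler_pdivrMl// mulrC.
  by rewrite (le_trans _ (expR_ge1Dxn q (normr_ge0 x)))// lerDr.
rewrite (le_trans h)// ler_pM2l//.
by case: (ger0P x) => x0; [rewrite lerDl expR_ge0|rewrite lerDr expR_ge0].
Qed.

Context {d0 : measure_display} {T : measurableType d0}.
Variable P : probability T R.

(** In the quadratic bound for the exponential the linear term integrates to zero, so only a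
    second-order term in [l * B] remains. *)
Lemma integral_expR_centered_le (X : T -> R) (B l : R) :
  measurable_fun setT X -> (forall w, `|X w| <= B) ->
  (\int[P]_w (X w)%:E = 0)%E -> `|l| * B <= 2^-1 ->
  (\int[P]_w (expR (l * X w))%:E <= (1 + 2 * (l * B) ^+ 2)%:E)%E.
Proof.
move=> mX XB X0 lB.
have lX w : `|l * X w| <= `|l| * B by rewrite normrM ler_wpM2l.
have iX : P.-integrable setT (EFin \o X).
  apply: (@le_integrable _ _ _ P setT _ (EFin \o X) (cst B%:E)) => //.
  - exact/measurable_EFinP.
  - move=> w _ /=; rewrite lee_fin (le_trans (XB w))// ler_norm//.
  - exact: finite_measure_integrable_cst.
have ilX : P.-integrable setT (fun w => l%:E * (X w)%:E)%E by exact: integrableZl.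
rewrite (@le_trans _ _ (\int[P]_w ((1 + 2 * (l * B) ^+ 2)%:E + l%:E * (X w)%:E))%E)//.
  apply: ge0_le_integral => //.
  - apply/measurable_EFinP; apply: measurableT_comp => //.
    exact: measurable_funM.
  - by apply: emeasurable_funD => //; exact: measurable_int ilX.
  - move=> w _; rewrite -EFinM -EFinD lee_fin.
    rewrite (le_trans (expR_le_quadratic _))//.
      by rewrite (le_trans _ lB)// (le_trans _ (lX w))// ler_norm.
    rewrite addrAC lerD2r lerD2l ler_pM2l// -[leLHS]real_normK ?num_real//.
    rewrite -[leRHS]real_normK ?num_real// lerXn2r ?nnegrE//.
    by rewrite [leRHS]normrM (le_trans (lX w))// ler_wpM2l// ler_norm.
rewrite integralD//=; last exact: finite_measure_integrable_cst.
rewrite integralZl//= X0 mule0 adde0 integral_cst//= probability_setT mule1//.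
Qed.

Section Block.
Variables (tau : nat -> {RV P >-> R}) (psi : nat -> R -> R) (B : R).
Hypothesis indep : mutually_independent P (fun j => tau j).
Hypothesis mpsi : forall j, measurable_fun setT (psi j).
Hypothesis B0 : 0 < B.
Hypothesis psiB : forall j x, `|psi j x| <= B.
Hypothesis psi0 : forall j, (\int[P]_w (psi j (tau j w))%:E = 0)%E.

Definition block_sum (s k : nat) (w : T) : R :=
  \sum_(s <= j < s + k) psi j (tau j w).

Lemma measurable_block_sum s k : measurable_fun setT (block_sum s k).
Proof.
by apply: measurable_sum => j; exact: measurableT_comp.
Qed.

Lemma integral_expR_block_sum (l : R) s k : `|l| * B <= 2^-1 ->
  (\int[P]_w (expR (l * block_sum s k w))%:E
     <= ((1 + 2 * (l * B) ^+ 2) ^+ k)%:E)%E.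
Proof.
move=> lB.
pose phi j x := expR (l * psi j x).
have le1 j : (\int[P]_w (phi j (tau j w))%:E <= (1 + 2 * (l * B) ^+ 2)%:E)%E.
  by apply: integral_expR_centered_le => //; exact: measurableT_comp.
have ge1 j : (0 <= \int[P]_w (phi j (tau j w))%:E)%E.
  by apply: integral_ge0 => w _; rewrite lee_fin expR_ge0.
have -> : (\int[P]_w (expR (l * block_sum s k w))%:E =
    \int[P]_w (\prod_(j <- index_iota s (s + k)) phi j (tau j w))%:E)%E.
  apply: eq_integral => w _; congr EFin.
  by rewrite /block_sum big_distrr/= expR_sum.
have mphi j : measurable_fun setT (phi j).
  by apply: measurableT_comp => //; exact: measurable_funM.
have phifin j : (\int[P]_w (phi j (tau j w))%:E)%E \is a fin_num.
  by rewrite ge0_fin_numE// (le_lt_trans (le1 j))// ltry.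
rewrite integral_prod_indep ?iota_uniq//; last by move=> j x; exact: expR_ge0.
rewrite /index_iota addKn.
elim: k s => [|k IH] s; first by rewrite big_nil expr0.
rewrite big_cons exprS EFinM; apply: lee_pmul => //.
by rewrite big_seq; apply: prode_ge0 => j _.
Qed.

Lemma integral_block_sum_moment (q : nat) s k : (0 < q)%N -> (0 < k)%N ->
  (\int[P]_w (`|block_sum s k w| ^+ q)%:E <=
   (2 * expR 1 * q`!%:R * (2 * B * Num.sqrt k%:R) ^+ q)%:E)%E.
Proof.
move=> q0 k0; have kR : 0 < k%:R :> R by rewrite ltr0n.
(* With [l = 1 / c] or [l = - 1 / c] one has [(l * B)^2 = 1 / (4 k)], so the exponential moment is
   at most [(1 + 1 / (2 k)) ^ k], bounded uniformly in [k]. *)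
set c := 2 * B * Num.sqrt k%:R; have c0 : 0 < c by rewrite !mulr_gt0// sqrtr_gt0.
have cB : c^-1 * B <= 2^-1.
  rewrite mulrC ler_pdivrMr// /c mulrA [2^-1 * _]mulrA mulVf// mul1r.
  rewrite ler_pMr// -[leLHS]sqrtr1 ler_sqrt// ler1n//.
have mgf (l : R) : `|l| = c^-1 ->
    (\int[P]_w (expR (l * block_sum s k w))%:E <= (expR 1)%:E)%E.
  move=> lc; rewrite (le_trans (integral_expR_block_sum s k _))// ?lc//.
  rewrite lee_fin.
  have -> : (l * B) ^+ 2 = (4 * k%:R)^-1.
    rewrite -[LHS]real_normK ?num_real// normrM lc (gtr0_norm B0).
    rewrite exprMn exprVn /c 2!exprMn sqr_sqrtr ?ltW//.
    by field; rewrite !gt_eqF.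
  rewrite (@le_trans _ _ (expR (2 * (4 * k%:R)^-1) ^+ k))//.
    by rewrite lerXn2r ?nnegrE ?expR_ge0 ?expR_ge1Dx// addr_ge0// mulr_ge0// invr_ge0 mulr_ge0.
  rewrite -expRM_natl ler_expR.
  have -> : k%:R * (2 * (4 * k%:R)^-1) = 2^-1 :> R by field; rewrite gt_eqF.
  by rewrite invf_le1// ler1n.
have mE (l : R) : measurable_fun setT (fun w => (expR (l * block_sum s k w))%:E).
  apply/measurable_EFinP; apply: measurableT_comp => //.
  by apply: measurable_funM => //; exact: measurable_block_sum.
have C0 : 0 <= q`!%:R * c ^+ q by rewrite mulr_ge0// exprn_ge0// ltW.
rewrite (@le_trans _ _ (\int[P]_w ((q`!%:R * c ^+ q)%:E *
   ((expR (c^-1 * block_sum s k w))%:E + (expR (- c^-1 * block_sum s k w))%:E)))%E)//.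
  apply: ge0_le_integral => //.
  - apply/measurable_EFinP; apply: measurable_funX; apply: measurableT_comp => //.
    exact: measurable_block_sum.
  - by apply: measurable_funeM; apply: emeasurable_funD.
  - move=> w _; rewrite -EFinD -EFinM lee_fin.
    have := exprn_le_expRDexpRN (c^-1 * block_sum s k w) q0.
    rewrite normrM exprMn gtr0_norm ?invr_gt0// exprVn -ler_pdivlMl ?invr_gt0 ?exprn_gt0//.
    rewrite invrK mulNr => /le_trans; apply.
    by rewrite mulrCA mulrA.
rewrite ge0_integralZl//; last 2 first.
- exact: emeasurable_funD.
- by move=> w _; rewrite adde_ge0.
rewrite ge0_integralD//.
rewrite (@le_trans _ _ ((q`!%:R * c ^+ q)%:E * ((expR 1)%:E + (expR 1)%:E))%E)//.
  rewrite lee_wpmul2l// leeD// mgf// ?normrN gtr0_norm// invr_gt0//.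
by rewrite -EFinD -EFinM lee_fin le_eqVlt; apply/orP; left; apply/eqP; ring.
Qed.

(* Dyadic majorant of [max_(k <= 2 ^ l) |block_sum s k w| ^+ q]: a maximum over
   the second half is at most the full first half plus a maximum started afresh. *)
Fixpoint dyadic_max (q l s : nat) (w : T) : R :=
  match l with
  | 0 => `|block_sum s 1 w| ^+ q
  | l'.+1 => dyadic_max q l' s w
      + (1 + 2 * q%:R) ^+ q * `|block_sum s (2 ^ l') w| ^+ q
      + 2 * dyadic_max q l' (s + 2 ^ l') w
  end.

Lemma dyadic_max_ge0 q l s w : 0 <= dyadic_max q l s w.
Proof.
elim: l s => [|l IH] s /=; first exact: exprn_ge0.
by rewrite !addr_ge0 ?mulr_ge0 ?exprn_ge0 ?addr_ge0 ?mulr_ge0.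
Qed.

Lemma measurable_dyadic_max q l s : measurable_fun setT (dyadic_max q l s).
Proof.
have mS r k : measurable_fun setT (fun w => `|block_sum r k w| ^+ q).
  apply: measurable_funX; apply: measurableT_comp => //.
  exact: measurable_block_sum.
elim: l s => [|l IH] s /=; first exact: mS.
apply: measurable_funD; last exact: measurable_funM.
by apply: measurable_funD => //; exact: measurable_funM.
Qed.

Lemma block_sum_le_dyadic_max q l s k w : (0 < q)%N -> (k <= 2 ^ l)%N ->
  `|block_sum s k w| ^+ q <= dyadic_max q l s w.
Proof.
move=> q0; elim: l s k => [|l IH] s k /=.
  rewrite expn0; case: k => [_|[|//]]; last by rewrite lexx.
  by rewrite /block_sum addn0 big_geq// normr0 expr0n (gtn_eqF q0) exprn_ge0.
move=> kl; have [kl'|kl'] := leqP k (2 ^ l).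
  rewrite (le_trans (IH s k kl'))// -addrA lerDl.
  by rewrite addr_ge0 ?mulr_ge0 ?exprn_ge0 ?addr_ge0 ?mulr_ge0 ?dyadic_max_ge0.
have -> : block_sum s k w =
    block_sum s (2 ^ l) w + block_sum (s + 2 ^ l) (k - 2 ^ l) w.
  rewrite /block_sum -addnA subnKC; last exact: ltnW.
  by rewrite -big_cat_nat ?leq_addr// leq_add2l ltnW.
rewrite (le_trans (normrD_exp_le _ _ q0))// -addrA ler_wpDl ?dyadic_max_ge0//.
rewrite lerD2l ler_pM2l// IH// leq_subLR.
by rewrite addnn -mul2n -expnS.
Qed.

(** Each bisection yields [1 + 1 + 2 = 4] copies of the bound at length [2 ^ l], while doubling the
    length multiplies the claimed bound by [sqrt 2 ^ q]. The latter is at least [4] exactly when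
    [q >= 4], so no constant accumulates with [l]. *)
Lemma integral_dyadic_max_le (q l s : nat) : (4 <= q)%N ->
  (\int[P]_w (dyadic_max q l s w)%:E <=
   ((1 + 2 * q%:R) ^+ q * (2 * expR 1 * q`!%:R) *
    (2 * B * Num.sqrt (2 ^ l)%:R) ^+ q)%:E)%E.
Proof.
move=> q4; have q0 : (0 < q)%N by exact: leq_trans q4.
set c := (1 + 2 * q%:R) ^+ q; set A := 2 * expR 1 * q`!%:R.
have c1 : 1 <= c by rewrite exprn_ege1// lerDl mulr_ge0.
have c0 : 0 <= c by rewrite (le_trans _ c1).
have A0 : 0 <= A by rewrite !mulr_ge0// expR_ge0.
elim: l s => [|l IH] s /=.
  rewrite (le_trans (integral_block_sum_moment s q0 (ltn0Sn 0)))//.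
  rewrite lee_fin expn0 -[c * A * _]mulrA ler_peMl// mulr_ge0// exprn_ge0//.
  by rewrite !mulr_ge0 ?sqrtr_ge0// ltW.
have mS r k : measurable_fun setT (fun w => (`|block_sum r k w| ^+ q)%:E).
  apply/measurable_EFinP; apply: measurable_funX; apply: measurableT_comp => //.
  exact: measurable_block_sum.
have mD r : measurable_fun setT (fun w => (dyadic_max q l r w)%:E).
  exact/measurable_EFinP/measurable_dyadic_max.
under eq_integral do rewrite !EFinD !EFinM.
have D0 r w : (0 <= (dyadic_max q l r w)%:E)%E by rewrite lee_fin dyadic_max_ge0.
have S0 r k w : (0 <= (`|block_sum r k w| ^+ q)%:E)%E by rewrite lee_fin exprn_ge0.
have cE : (0 <= c%:E)%E by rewrite lee_fin.
have two : (0 <= 2%:E :> \bar R)%E by rewrite lee_fin.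
rewrite (ge0_integralD P measurableT); last 4 first.
- by move=> w _; rewrite adde_ge0// mule_ge0.
- by apply: emeasurable_funD => //; exact: measurable_funeM.
- by move=> w _; rewrite mule_ge0.
- exact: measurable_funeM.
rewrite (ge0_integralD P measurableT); last 4 first.
- by [].
- by [].
- by move=> w _; rewrite mule_ge0.
- exact: measurable_funeM.
rewrite ge0_integralZl//.
rewrite ge0_integralZl//.
set V := (2 * B * Num.sqrt (2 ^ l)%:R) ^+ q.
have V0 : 0 <= V by rewrite exprn_ge0// !mulr_ge0 ?sqrtr_ge0// ltW.
rewrite (@le_trans _ _ ((c * A * V)%:E + c%:E * (A * V)%:E + 2%:E * (c * A * V)%:E)%E)//.
  apply: leeD; last by rewrite lee_pmul2l//; exact: IH.
  apply: leeD; first exact: IH.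
  rewrite lee_wpmul2l// integral_block_sum_moment// expn_gt0//.
rewrite -!EFinM -!EFinD lee_fin.
have -> : (2 * B * Num.sqrt (2 ^ l.+1)%:R) ^+ q = Num.sqrt 2 ^+ q * V.
  by rewrite -exprMn expnS natrM sqrtrM//; congr (_ ^+ q); ring.
have -> : c * A * V + c * (A * V) + 2 * (c * A * V) = 4 * (c * A * V) by ring.
rewrite [c * A * (_ * V)]mulrCA ler_wpM2r ?mulr_ge0//.
rewrite -(subnK q4) exprD.
have -> : Num.sqrt 2 ^+ 4 = 4 :> R.
  by rewrite (exprM _ 2 2) sqr_sqrtr//; ring.
rewrite ler_peMl// exprn_ege1// -[leLHS]sqrtr1 ler_sqrt// ler1n//.
Qed.

End Block.
End MaximalInequality.

(** * Deterministic error bound along one sample path *)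

Section PathwiseError.
Context {R : realType} {d : nat}.
Variables (a b K L rho : R) (eta : 'rV[R]_d) (f : R -> 'rV[R]_d -> 'rV[R]_d).
Variables (z : R -> 'rV[R]_d) (n : nat) (q : R).
Hypotheses (ab : a < b) (K0 : 0 < K) (L0 : 0 < L) (rho01 : 0 < rho <= 1).
Hypotheses (Ff : inF a b K L rho eta f) (odez : ode_solution a b eta f z).
Hypothesis n0 : (0 < n)%N.

Let h := (b - a) / n%:R.

Hypotheses (h1 : h <= 1) (Lhq : L * h <= q < 1).

Lemma step_gt0 : 0 < h.
Proof. by rewrite divr_gt0 ?subr_gt0// ltr0n. Qed.

Lemma node_bounds k : (k < n)%N -> a <= a + k%:R * h /\ a + k%:R * h + h <= b.
Proof.
move=> kn; have h0 := ltW step_gt0; split; first by rewrite lerDl mulr_ge0.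
rewrite -addrA -lerBrDl -{2}[h]mul1r -mulrDl natr1 (@le_trans _ _ (n%:R * h))//.
  by rewrite ler_wpM2r// ler_nat.
by rewrite /h mulrCA mulfV ?mulr1// gt_eqF// ltr0n.
Qed.

Lemma pathwise_error_le (s : nat -> R) (M : R) :
  (forall j, (j < n)%N -> 0 <= s j <= 1) ->
  (forall k, (k <= n)%N -> enorm (\row_i (\sum_(0 <= j < k)
       quadrature_error f z (a + j%:R * h) h i (s j))) <= M) ->
  forall k, (k <= n)%N ->
  enorm (z (a + k%:R * h) - S2 a h eta f s k) <=
  expR ((b - a) * L / (1 - q)) *
    (d%:R * (@holder_const R d a b K L * (h * h `^ rho)) + M).
Proof.
move=> s01 SM k kn.
have h0 := step_gt0; have h01 : 0 < h <= 1 by rewrite h0 h1.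
case: (Ff) => _ _ _ _ flip.
pose e k := z (a + k%:R * h) - S2 a h eta f s k.
pose S k : 'rV[R]_d := \row_i (\sum_(0 <= j < k)
       quadrature_error f z (a + j%:R * h) h i (s j)).
have /andP[Lq q1] := Lhq.
have -> : (b - a) * L / (1 - q) = n%:R * (h * L / (1 - q)).
  rewrite [RHS]mulrA [n%:R * (h * L)]mulrA /h.
  by congr (_ * _ * _); rewrite mulrCA mulfV ?mulr1// gt_eqF// ltr0n.
apply: (@discrete_gronwall _ _ e S s q h L _ M n) => //; try exact: ltW.
- by rewrite mulr_ge0// mulr_ge0 ?(ltW (holder_const_gt0 _ _ _ _))// mulr_ge0 ?powR_ge0// ltW.
- by rewrite /e mul0r addr0; case: odez => -> _ _; rewrite subrr.
- by apply/rowP => i; rewrite !mxE big_geq.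
move=> {kn}k kn; have [tk tkb] := node_bounds kn; have sk := s01 k kn.
set t := a + k%:R * h in tk tkb.
have tS : a + k.+1%:R * h = t + h by rewrite -natr1 mulrDl mul1r addrA.
set x := S2 a h eta f s k.
set y := S2 a h eta f s k.+1.
have /andP[sk0 sk1] := sk.
have thab : a <= t + h * s k <= b.
  apply/andP; split; first by rewrite (le_trans tk)// lerDl mulr_ge0// ltW.
  by rewrite (le_trans _ tkb)// lerD2l ler_piMr// ltW.
have yE : y = x + h *: f (t + h * s k) ((1 - s k) *: x + s k *: y).
  exact: (S2_stepE _ (ltW h0) sk (ltW L0) (le_lt_trans Lq q1)
            (fun u v => flip _ u v thab)).
have SE : S k.+1 - S k = z (t + h) - z t - h *: f (t + h * s k) (z (t + h * s k)).
  apply/rowP => i; rewrite !mxE big_nat_recr//= addrAC subrr add0r.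
  by rewrite /quadrature_error patchE mem_set//= in_itv.
(* The quadrature error cancels, leaving a difference of two values of [f] at the same time. *)
have -> : e k.+1 - S k.+1 - (e k - S k) = h *: (f (t + h * s k) (z (t + h * s k))
    - f (t + h * s k) ((1 - s k) *: x + s k *: y)).
  have -> : e k.+1 - S k.+1 - (e k - S k) = (e k.+1 - e k) - (S k.+1 - S k).
    by rewrite (opprB (e k)) (opprB (S k.+1)) [S k - e k]addrC addrACA [- S k.+1 + _]addrC.
  rewrite SE /e tS -/t -/x -/y {1}yE scalerBr.
  apply/rowP => i; rewrite !mxE; ring.
rewrite enormZ gtr0_norm// -mulrA ler_pM2l// (le_trans (flip _ _ _ _))//.
rewrite ler_pM2l//.
(* The arguments differ by the interpolation error of [z] plus the convex combination of the two
   neighbouring errors. *)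
have -> : z (t + h * s k) - ((1 - s k) *: x + s k *: y) =
   (z (t + h * s k) - ((1 - s k) *: z t + s k *: z (t + h))) +
   (1 - s k) *: e k + s k *: e k.+1.
  by rewrite /e tS -/t -/x -/y; apply/rowP => i; rewrite !mxE; ring.
rewrite (le_trans (ler_enormD _ _))// lerD//; last by rewrite enormZ ger0_norm.
rewrite (le_trans (ler_enormD _ _))// lerD//; last first.
  by rewrite enormZ ger0_norm// subr_ge0.
exact: (interpolation_error_le ab K0 L0 rho01 Ff odez).
Qed.

End PathwiseError.

(** * From the sample space to [[0, 1]], and domination almost everywhere *)

Section Transfer.
Context {R : realType} {d0 : measure_display} {T : measurableType d0}.
Variable P : probability T R.

Lemma uniform01_ae (X : {RV P >-> R}) : uniform01 P X ->
  \forall w \ae P, 0 <= X w <= 1.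
Proof.
move=> UX; exists (X @^-1` ~` `[0, 1]); split.
- by apply: measurable_funPTI => //; apply: measurableC; exact: measurable_itv.
- rewrite UX; last by apply: measurableC; exact: measurable_itv.
  by rewrite setICl measure0.
- by move=> w /=; rewrite in_itv.
Qed.

Lemma integral_uniform01 (X : {RV P >-> R}) (psi : R -> R) (B : R) :
  uniform01 P X -> measurable_fun setT psi -> (forall x, `|psi x| <= B) ->
  (forall x, ~ (0 <= x <= 1) -> psi x = 0) ->
  (\int[P]_w (psi (X w))%:E =
   \int[lebesgue_measure]_(x in `[0%R, 1%R]) (psi x)%:E)%E.
Proof.
move=> UX mpsi psiB psi0.
have m01 : measurable (`[0, 1]%classic : set R) by exact: measurable_itv.
have mX01 : measurable (X @^-1` `[0, 1]) by exact: measurable_funPTI.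
have mpsiX : measurable_fun setT (psi \o X) by exact: measurableT_comp.
transitivity (\int[P]_(w in X @^-1` `[0%R, 1%R]) (psi (X w))%:E)%E.
  rewrite [RHS]integral_mkcond; apply: eq_integral => w _.
  rewrite patchE; case: ifPn => // /negP wX; rewrite psi0// => w01.
  by apply: wX; rewrite inE/= in_itv.
(* The law of [X] has to be compared with [lebesgue_measure] on the measurable type carrying the
   latter, so [X] is repackaged with that codomain. *)
pose Y := measurableTypeR R.
have mXR : measurable_fun setT X by [].
have mX : measurable_fun setT (X : T -> Y) by move=> mT A mA; exact: mXR mT A mA.
pose Xm : {mfun T >-> Y} := HB.pack (X : T -> Y) (isMeasurableFun.Build _ _ _ _ _ mX).
rewrite -(@integral_pushforward _ _ T Y R X mX P `[0, 1]%classic (EFin \o psi))//.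
- apply: (@eq_measure_integral _ Y R _ lebesgue_measure (pushforward P Xm)).
  move=> A mA A01; rewrite [LHS]UX//.
  by congr (lebesgue_measure _); exact/setIidPl.
- exact/measurable_EFinP.
- apply: (@le_integrable _ _ _ P _ mX01 _ (cst B%:E)) => //.
  + by apply/measurable_EFinP; exact: measurable_funTS.
  + by move=> w _ /=; rewrite lee_fin (le_trans (psiB _))// ler_norm.
  + exact: finite_measure_integrable_cst.
Qed.

Import HBNNSimple.

(* No measurability of [F]: the integral of a nonnegative function is a supremum
   over the measurable simple functions below it. *)
Lemma ge0_ae_le_integral_dominated (F G : T -> \bar R) :
  (forall w, 0 <= F w)%E -> (forall w, 0 <= G w)%E -> measurable_fun setT G ->
  (\forall w \ae P, (F w <= G w)%E) -> (\int[P]_w F w <= \int[P]_w G w)%E.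
Proof.
move=> F0 G0 mG FG; rewrite ge0_integralTE//.
apply: ge_ereal_sup => _ [u uF <-]; rewrite -integralT_nnsfun.
apply: ae_ge0_le_integral => //.
- by move=> w _; rewrite lee_fin.
- exact/measurable_EFinP.
- by apply: filterS FG => w Fw _; exact: le_trans (uF w) Fw.
Qed.

End Transfer.

(** * Maximal majorant, choice of constants and the final estimate *)

Definition maximal_const {R : realType} (m : nat) : R :=
  (1 + 2 * m%:R) ^+ m * (2 * expR 1 * m`!%:R).

Lemma maximal_const_ge0 (R : realType) m : 0 <= maximal_const m :> R.
Proof.
by rewrite mulr_ge0 ?exprn_ge0 ?addr_ge0 ?mulr_ge0 ?expR_ge0.
Qed.

Lemma exists_pow2_between n : (0 < n)%N -> exists l, (n <= 2 ^ l <= 2 * n)%N.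
Proof.
move=> n0; have /andP[h1 h2] := trunc_log_bounds (ltnSn 1) n0.
by exists (trunc_log 2 n).+1; rewrite (ltnW h2) expnS leq_mul2l h1.
Qed.

Lemma le_root (R : realType) (x y : R) (m : nat) : (0 < m)%N -> 0 <= x ->
  x ^+ m <= y -> x <= y `^ m%:R^-1.
Proof.
move=> m0 x0 xy; have m0R : m%:R != 0 :> R by rewrite pnatr_eq0 -lt0n.
have -> : x = (x ^+ m) `^ m%:R^-1.
  by rewrite -powR_mulrn// -powRrM mulfV// powRr1.
have xm0 : 0 <= x ^+ m by exact: exprn_ge0.
by rewrite ge0_ler_powR ?nnegrE ?invr_ge0// (le_trans xm0).
Qed.

(** A single measurable [Q] controls all coordinates and all partial sums: it is the sum over
    coordinates of the dyadic majorants, for [n <= 2 ^ l <= 2 * n]. Scaling by [sigma], later the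
    target rate, lets the mean of [Q] be bounded independently of [n]. *)
Lemma exists_maximal_majorant (R : realType) (d0 : measure_display)
    (T : measurableType d0) (P : probability T R) (tau : nat -> {RV P >-> R})
    (d : nat) (psi : 'I_d -> nat -> R -> R) (B sigma : R) (m n : nat) :
  mutually_independent P (fun j => tau j) ->
  (forall i j, measurable_fun setT (psi i j)) ->
  0 < B -> (forall i j x, `|psi i j x| <= B) ->
  (forall i j, (\int[P]_w (psi i j (tau j w))%:E = 0)%E) ->
  0 < sigma -> (4 <= m)%N -> (0 < n)%N ->
  exists Q : T -> R, [/\ measurable_fun setT Q, (forall w, 0 <= Q w),
    (forall w i k, (k <= n)%N ->
       `|block_sum tau (psi i) 0 k w| <= sigma * Q w `^ m%:R^-1) &
    (\int[P]_w (Q w)%:E <=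
     (d%:R * (maximal_const m * (2 * B * Num.sqrt (2 * n%:R) / sigma) ^+ m))%:E)%E].
Proof.
move=> indep mpsi B0 psiB psi0 sg0 m4 n0; have m0 : (0 < m)%N by exact: leq_trans m4.
have [l /andP[nl ln]] := exists_pow2_between n0.
have sV0 : 0 <= sigma ^- m by rewrite invr_ge0 exprn_ge0// ltW.
pose D i := dyadic_max tau (psi i) m l 0.
have D0 i w : 0 <= D i w by exact: dyadic_max_ge0.
have mD i : measurable_fun setT (D i) by exact: measurable_dyadic_max.
exists (fun w => \sum_(i < d) sigma ^- m * D i w); split.
- by apply: measurable_sum => i; exact: measurable_funM.
- by move=> w; apply: sumr_ge0 => i _; exact: mulr_ge0.
- move=> w i k kn; rewrite -ler_pdivrMl//; apply: le_root => //.
    by rewrite mulr_ge0// invr_ge0 ltW.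
  rewrite (bigD1 i)//= ler_wpDr ?sumr_ge0// => [j _|]; first exact: mulr_ge0.
  rewrite exprMn exprVn ler_wpM2l// block_sum_le_dyadic_max//.
  exact: leq_trans kn nl.
under eq_integral do rewrite -sumEFin.
rewrite ge0_integral_sum//; last 2 first.
- by move=> i; apply/measurable_EFinP; exact: measurable_funM.
- by move=> i w _; rewrite lee_fin mulr_ge0.
set V := maximal_const m * _.
rewrite (@le_trans _ _ (\sum_(i < d) V%:E)%E)//; last first.
  by rewrite sumEFin sumr_const card_ord mulr_natl.
apply: lee_sum => i _.
under eq_integral do rewrite EFinM.
rewrite ge0_integralZl//; last 2 first.
- exact/measurable_EFinP.
- by move=> w _; rewrite lee_fin.
rewrite (@le_trans _ _ ((sigma ^- m)%:E *
   (maximal_const m * (2 * B * Num.sqrt (2 ^ l)%:R) ^+ m)%:E)%E)//.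
  by rewrite lee_wpmul2l//; exact: integral_dyadic_max_le.
rewrite -EFinM lee_fin /V mulrCA ler_wpM2l ?maximal_const_ge0//.
rewrite -exprVn -exprMn [_ / sigma]mulrC.
rewrite lerXn2r ?nnegrE ?mulr_ge0 ?invr_ge0 ?sqrtr_ge0 ?(ltW sg0) ?(ltW B0)//.
rewrite ler_wpM2l ?invr_ge0 ?(ltW sg0)// ler_wpM2l ?mulr_ge0 ?(ltW B0)//.
by rewrite ler_wsqrtr// -natrM ler_nat.
Qed.

(** Passes from the integer moment [m] to the real exponent [p]: since [1 + Q >= 1] and [p <= m],
    the power [p / m] of [1 + Q] is at most [1 + Q]. The bound is affine in [Q], so the mean of [Q]
    suffices afterwards. *)
Lemma powR_le_affine (R : realType) (x A Q p : R) (m : nat) :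
  (0 < m)%N -> 0 <= p <= m%:R -> 0 <= A -> 0 <= Q -> 0 <= x ->
  x <= A * (1 + Q `^ m%:R^-1) -> x `^ p <= (2 * A) `^ p * (1 + Q).
Proof.
move=> m0 /andP[p0 pm] A0 Q0 x0 xA; have m0R : 0 < m%:R :> R by rewrite ltr0n.
have Q1 : 1 <= 1 + Q by rewrite lerDl.
have xle : x <= 2 * A * (1 + Q) `^ m%:R^-1.
  rewrite (le_trans xA)// [2 * A]mulrC -mulrA ler_wpM2l// mulr2n mulrDl mul1r lerD//.
    rewrite -[leLHS](@powRr0 _ (1 + Q)) ler_powR// invr_ge0 ltW//.
  by rewrite ge0_ler_powR ?nnegrE ?invr_ge0 ?(ltW m0R) ?addr_ge0// lerDr.
rewrite (@le_trans _ _ ((2 * A * (1 + Q) `^ m%:R^-1) `^ p))//.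
  by rewrite ge0_ler_powR ?nnegrE// (le_trans x0).
rewrite powRM ?mulr_ge0 ?powR_ge0// ler_wpM2l ?powR_ge0// -powRrM.
by rewrite ler1_powR// mulrC ler_pdivrMr// mul1r.
Qed.

Theorem theorem2 (R : realType) (a b : R) (d : nat) (K L rho p : R) :
  a < b -> (0 < d)%N -> 0 < rho <= 1 -> 0 < K -> 0 < L -> 2 <= p ->
  exists C : R, 0 < C /\
  forall (n : nat), (Num.floor (b - a) + 1 <= n%:Z)%R ->
  let h := (b - a) / n%:R in
  L * h < 1 ->
  forall (eta : 'rV[R]_d) (f : R -> 'rV[R]_d -> 'rV[R]_d),
  inF a b K L rho eta f ->
  forall z : R -> 'rV[R]_d, ode_solution a b eta f z ->
  forall (d0 : measure_display) (T : measurableType d0) (P : probability T R)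
    (tau : nat -> {RV P >-> R}),
  mutually_independent P (fun j => tau j) ->
  (forall j, uniform01 P (tau j)) ->
  (poweR (\int[P]_w
     ((\big[Num.max/0]_(j < n.+1)
        (enorm (z (a + (j : nat)%:R * h)
                - S2 a h eta f (fun i => tau i w) j) `^ p))%:E))%E
        p^-1
  <= (C * h `^ (rho + 2^-1))%:E)%E.
Proof.
move=> ab dpos rho01 K0 L0 p2.
have p0 : 0 < p by apply: lt_le_trans p2.
have ba0 : 0 < b - a by rewrite subr_gt0.
pose c0 := @holder_const R d a b K L.
have c0_gt0 : 0 < c0 by exact: holder_const_gt0.
(* [N0] is the least [n] with [L * h < 1], so [q] bounds [L * h] away from 1. *)
pose N0 := (Num.truncn (L * (b - a))).+1.
pose q := L * (b - a) / N0%:R.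
have q1 : q < 1 by rewrite ltr_pdivrMr ?ltr0n// mul1r truncnS_gt.
(* An integer above [p] that is at least [4], as bisection requires. *)
pose m := (Num.truncn p).+4.
have pm : p <= m%:R.
  by rewrite (le_trans (ltW (truncnS_gt p)))// ler_nat /m -addn3 leq_addr.
(* Gronwall factor times the dimension; in [c0 + 1], [c0] accounts for interpolation and [1] for the
   maximal sum. *)
pose A := expR ((b - a) * L / (1 - q)) * (d%:R * (c0 + 1)).
have A0 : 0 < A by rewrite !mulr_gt0 ?expR_gt0 ?ltr0n ?addr_gt0.
(* Bound on the mean of [Q], free of [n] because [sqrt h * sqrt (2 n) = sqrt (2 (b - a))]. *)
pose CQ := d%:R * (maximal_const m * (2 * c0 * Num.sqrt (2 * (b - a))) ^+ m).
have CQ0 : 0 <= CQ.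
  rewrite mulr_ge0// mulr_ge0 ?maximal_const_ge0//; apply: exprn_ge0.
  by rewrite mulr_ge0 ?sqrtr_ge0// mulr_ge0// ltW.
exists (2 * A * (1 + CQ) `^ p^-1); split.
  by rewrite mulr_gt0 ?powR_gt0 ?ltr_wpDr// mulr_gt0.
move=> n nf h Lh eta f Ff z odez d0 T P tau indep unif.
have n_gt : b - a < n%:R.
  rewrite (lt_le_trans (floorD1_gt _))//.
  by have := nf; rewrite -(ler_int R).
have nR0 : 0 < n%:R :> R by exact: lt_trans n_gt.
have n0 : (0 < n)%N by rewrite -(ltr0n R).
have h0 : 0 < h by rewrite divr_gt0.
have h1 : h <= 1 by rewrite ler_pdivrMr// mul1r ltW.
have h01 : 0 < h <= 1 by rewrite h0 h1.
have Lhq : L * h <= q < 1.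
  rewrite q1 andbT /h /q mulrA ler_wpM2l ?mulr_ge0 ?(ltW L0) ?(ltW ba0)//.
  rewrite lef_pV2 ?posrE ?ltr0n// ler_nat ltnNge; apply/negP => nN.
  move: Lh; rewrite /h mulrA ltr_pdivrMr// mul1r ltNge => /negP; apply.
  rewrite (@le_trans _ _ (Num.truncn (L * (b - a)))%:R) ?ler_nat//.
  by rewrite truncn_le// mulr_ge0// ltW.
pose sg := h `^ (rho + 2^-1).
have sg0 : 0 < sg by rewrite powR_gt0.
(* The spare factor [sqrt h] compensates the [sqrt n] growth of the maximal sum. *)
have hsg : h * h `^ rho = sg * Num.sqrt h.
  rewrite /sg powRD ?powR12_sqrt ?(ltW h0)//; last by rewrite (gt_eqF h0) implybT.
  by rewrite -mulrA -expr2 sqr_sqrtr ?(ltW h0)// mulrC.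
have hsg1 : h * h `^ rho <= sg.
  by rewrite hsg ler_piMr ?(ltW sg0)// -[leRHS]sqrtr1 ler_wsqrtr.
pose B := c0 * (h * h `^ rho).
have B0 : 0 < B by rewrite mulr_gt0// mulr_gt0// powR_gt0.
(* The dyadic block may run past [n], where nodes lie outside [[a, b]]; those terms are set to
   zero. *)
pose psi (i : 'I_d) (j : nat) : R -> R :=
  if (j < n)%N then quadrature_error f z (a + j%:R * h) h i else cst 0.
have mpsi i j : measurable_fun setT (psi i j).
  rewrite /psi; case: ifPn => // jn; have [h2 h3] := node_bounds ab n0 jn.
  exact: (measurable_quadrature_error Ff odez h2 h3 h01).
have psiB i j x : `|psi i j x| <= B.
  rewrite /psi; case: ifPn => [jn|_]; last by rewrite normr0 ltW.
  have [h2 h3] := node_bounds ab n0 jn.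
  exact: (norm_quadrature_error_le ab K0 L0 rho01 Ff odez h2 h3 h01).
have psi_out i j x : ~ (0 <= x <= 1) -> psi i j x = 0.
  rewrite /psi; case: ifPn => // _ x01; rewrite /quadrature_error patchE.
  by case: ifPn => //; rewrite inE/= in_itv.
have psi0 i j : (\int[P]_w (psi i j (tau j w))%:E = 0)%E.
  rewrite (integral_uniform01 (unif j) (mpsi i j) (psiB i j) (psi_out i j)).
  rewrite /psi; case: ifPn => [jn|_]; last exact: integral0.
  have [h2 h3] := node_bounds ab n0 jn.
  exact: (integral_quadrature_error Ff odez h2 h3 h01).
have [//|Q [mQ Q0 QS QI]] := @exists_maximal_majorant _ _ _ _ tau d psi B sg m n
  indep mpsi B0 psiB psi0 sg0 _ n0.
have QI' : (\int[P]_w (Q w)%:E <= CQ%:E)%E.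
  rewrite (le_trans QI)// lee_fin /CQ; set X := _ / sg.
  suff -> : X = 2 * c0 * Num.sqrt (2 * (b - a)) by [].
  have -> : 2 * (b - a) = h * (2 * n%:R).
    by rewrite mulrCA; congr (2 * _); rewrite /h divfK// gt_eqF.
  rewrite /X /B hsg (sqrtrM _ (ltW h0)).
  by field; rewrite gt_eqF.
have pathwise w : (forall j, 0 <= tau j w <= 1) -> forall k, (k <= n)%N ->
    enorm (z (a + k%:R * h) - S2 a h eta f (fun i => tau i w) k) `^ p <=
    (2 * (A * sg)) `^ p * (1 + Q w).
  move=> tau01 k kn.
  apply: (@powR_le_affine _ _ _ _ _ m) => //.
  - by rewrite (ltW p0) pm.
  - by rewrite mulr_ge0// ltW.
  - exact: enorm_ge0.
  have err := @pathwise_error_le R d a b K L rho eta f z n q ab K0 L0 rho01 Ff odez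
    n0 h1 Lhq (fun i => tau i w) (d%:R * (sg * Q w `^ m%:R^-1)) (fun j _ => tau01 j).
  rewrite (le_trans (err _ k kn))//.
    move=> {err kn}k kn; apply: enorm_le_card => i; rewrite mxE.
    rewrite (le_trans _ (QS w i k kn))// /block_sum add0n.
    rewrite le_eqVlt; apply/orP; left; apply/eqP; congr `|_|.
    apply: eq_big_nat => j /andP[_ jk].
    by rewrite /psi (leq_trans jk kn).
  set Y := Q w `^ _; have Y0 : 0 <= Y by exact: powR_ge0.
  have -> : A * sg * (1 + Y) = expR ((b - a) * L / (1 - q)) *
      (d%:R * (c0 * sg + sg * Y + (sg + c0 * (sg * Y)))) by rewrite /A; ring.
  rewrite (ler_pM2l (expR_gt0 _)) -mulrDr ler_pM2l ?ltr0n// -/c0.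
  apply: (@le_trans _ _ (c0 * sg + sg * Y)).
    by rewrite lerD2r (ler_pM2l c0_gt0).
  rewrite lerDl.
  exact: addr_ge0 (ltW sg0) (mulr_ge0 (ltW c0_gt0) (mulr_ge0 (ltW sg0) Y0)).
have D0 : 0 <= (2 * (A * sg)) `^ p by exact: powR_ge0.
have Q0E w : (0 <= 1 + (Q w)%:E)%E by apply: adde_ge0; rewrite lee_fin.
have mQE : measurable_fun setT (fun w => 1 + (Q w)%:E)%E.
  by apply: emeasurable_funD => //; exact/measurable_EFinP.
have I1 : (\int[P]_w ((\big[Num.max/0]_(j < n.+1)
        (enorm (z (a + (j : nat)%:R * h)
                - S2 a h eta f (fun i => tau i w) j) `^ p))%:E)
    <= ((2 * (A * sg)) `^ p * (1 + CQ))%:E)%E.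
  rewrite (@le_trans _ _ (\int[P]_w (((2 * (A * sg)) `^ p)%:E * (1 + (Q w)%:E)))%E)//.
    apply: ge0_ae_le_integral_dominated.
    - by move=> w; rewrite lee_fin; apply: bigmax_ge_id.
    - by move=> w; rewrite mule_ge0.
    - exact: measurable_funeM.
    (* Countably many null sets are discarded, so all [tau j w] lie in [[0, 1]] at once. *)
    - have := ae_foralln (fun j => uniform01_ae (unif j)).
      apply: filterS => w tau01.
      rewrite -EFinD -EFinM lee_fin; apply: bigmax_le => [|k _].
        by rewrite mulr_ge0// addr_ge0.
      by apply: pathwise => //; rewrite -ltnS.
  rewrite ge0_integralZl//.
  rewrite ge0_integralD//; last 2 first.
  - by move=> w _; rewrite lee_fin.
  - exact/measurable_EFinP.
  rewrite EFinM lee_wpmul2l// EFinD leeD//.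
  by rewrite integral_cst// mul1e probability_le1.
rewrite (@le_trans _ _ (poweR ((2 * (A * sg)) `^ p * (1 + CQ))%:E p^-1))//.
  apply: gt0_ler_poweR => //.
  - by rewrite invr_ge0 ltW.
  - rewrite in_itv/= leey andbT; apply: integral_ge0 => w _.
    by rewrite lee_fin; apply: bigmax_ge_id.
  - by rewrite in_itv/= leey andbT lee_fin mulr_ge0// addr_ge0.
rewrite poweR_EFin lee_fin powRM// ?addr_ge0//.
rewrite -powRrM mulfV ?gt_eqF// powRr1; last first.
  exact: mulr_ge0 (ler0n _ 2) (mulr_ge0 (ltW A0) (ltW sg0)).
by rewrite -/sg le_eqVlt; apply/orP; left; apply/eqP; ring.
Qed.
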